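(* Let $Y$ be a locally compact space with a probability measure $P$ on $Y$, and let $\{T_i:Y\to\mathbb{R}\}$ be a finite collection of bounded continuous proper maps; regard all $T_i$ as maps $Y\to[c,d]$ for an interval $[c,d]\subseteq\mathbb{R}$ containing all their images. Then: (i) For an odd number of maps $T_1,\dots,T_{2n-1}$ the generalized distribution of the sample median (g.d.s.m.) is the probability distribution of the sample median, i.e. $\mu_{\{T_i\}}=P\circ T_{(n)}^{-1}$. Also, the image transformation $q_{\{T_i\}}$ equals $T_{(n)}^{-1}$. (ii) For an even number of maps $T_1,\dots,T_{2n}$ the g.d.s.m. is $\mu_{\{T_i\}}=\frac12P\circ T_{(n)}^{-1}+\frac12P\circ T_{(n+1)}^{-1}$. (iii) For an even number of maps $T_1,\dots,T_{2n}$ the g.d.s.m. is $\mu_{\{T_i\}}=\frac1{2n}\sum_{j=1}^{2n}\mu_{\{T_i\}}^{-j}$, where $\mu_{\{T_i\}}^{-j}$ is the g.d.s.m. of the $2n-1$ maps $\{T_i:1\le i\le 2n,\ i\ne j\}$.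
   Context: All spaces are Hausdorff. $P$ is a regular Borel probability measure. A map is proper if preimages of compact sets are compact. $T_{(k)}:Y\to\mathbb{R}$ denotes the $k$th order statistic: $T_{(k)}(y)$ is the $k$th smallest of the values $T_i(y)$ (counted with multiplicity). For $2n-1$ maps, $T_{(n)}$ is the sample median. Let $X=[c,d]$. A subset of $X$ is solid if it and its complement are connected ($\emptyset$ counts as connected); $\mathscr{A}_s^*(X)$ is the collection of solid sets that are open or closed in $X$. For $2n-1$ continuous proper maps $T_i:Y\to X$ put, for $A\in\mathscr{A}_s^*(X)$, $$q_{\{T_i\}}(A)=\bigcup_{S\subseteq\{1,\dots,2n-1\},|S|\ge n}\bigcap_{i\in S}T_i^{-1}(A)=\{y:|\{i:T_i(y)\in A\}|\ge n\}.$$ $q_{\{T_i\}}$ extends uniquely to an image transformation from $X$ to $Y$, i.e. a map $q:\mathscr{O}(X)\cup\mathscr{K}(X)\to\mathscr{O}(Y)\cup\mathscr{K}(Y)$ ($\mathscr{O}$ open sets, $\mathscr{K}$ compact sets) taking open sets to open sets and compact sets to compact sets, with $q(U)=\bigcup\{q(K):K\subseteq U,K\in\mathscr{K}(X)\}$ for open $U$, $q(K)=\bigcap\{q(U):K\subseteq U,U\in\mathscr{O}(X)\}$ for compact $K$, and $q(A\sqcup B)=q(A)\sqcup q(B)$ (disjoint unions) whenever $A,B,A\sqcup B\in\mathscr{O}(X)\cup\mathscr{K}(X)$; the extension is denoted by the same symbol. For an odd number $2n-1$ of maps, the g.d.s.m. is $\mu_{\{T_i\}}=P\circ q_{\{T_i\}}$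 on $\mathscr{O}(X)\cup\mathscr{K}(X)$ (so on $\mathscr{A}_s^*(X)$ it is $P(\{y:|\{i:T_i(y)\in A\}|\ge n\})$). For an even number $2n$ of maps, $\mu_{\{T_i\}}=\frac1{2n}\sum_{j=1}^{2n}\mu_{\{T_i\}}^{j}$, where $\mu_{\{T_i\}}^{j}$ is the g.d.s.m. of the $2n+1$ maps $T_1,\dots,T_{2n},T_j$. Equalities in (i)-(iii) are equalities of set functions on open and closed subsets of $[c,d]$ (equivalently, of Borel measures on $[c,d]$), and $q_{\{T_i\}}=T_{(n)}^{-1}$ means $q_{\{T_i\}}(A)=T_{(n)}^{-1}(A)$ for $A$ open or compact in $[c,d]$. *)

(* Defs.v *)
From HB Require Import structures.
From mathcomp Require Export all_boot all_order all_algebra.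
From mathcomp Require Export all_classical all_reals all_analysis.

Set Implicit Arguments.
Unset Strict Implicit.
Unset Printing Implicit Defensive.

Import Order.TTheory GRing.Theory Num.Theory.
Import numFieldNormedType.Exports.

Local Open Scope classical_set_scope.
Local Open Scope ring_scope.

Definition borelType (Y : ptopologicalType) := g_sigma_algebraType (@open Y).

Definition regular_measure (R : realType) (Y : ptopologicalType)
    (P : set (borelType Y) -> \bar R) : Prop :=
  forall A : set (borelType Y), measurable A ->
    P A = ereal_inf [set P U | U in [set U : set Y | open U /\ A `<=` U]] /\
    P A = ereal_sup [set P K | K in [set K : set Y | compact K /\ K `<=` A]].

Definition proper_map (Y Z : topologicalType) (f : Y -> Z) : Prop :=
  forall K : set Z, compact K -> compact (f @^-1` K).

Definition solid (X : topologicalType) (A : set X) : Prop :=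
  connected A /\ connected (~` A).

(* A map on open and compact sets is encoded as a function on all sets whose
   values elsewhere are irrelevant. *)
Definition image_transformation (X Y : topologicalType)
    (q : set X -> set Y) : Prop :=
  let OK (A : set X) := open A \/ compact A in
  [/\ forall U, open U -> open (q U),
      forall K, compact K -> compact (q K),
      forall U, open U ->
        q U = \bigcup_(K in [set K | K `<=` U /\ compact K]) q K,
      forall K, compact K ->
        q K = \bigcap_(U in [set U | K `<=` U /\ open U]) q U &
      forall A B, OK A -> OK B -> OK (A `|` B) -> A `&` B = set0 ->
        q A `&` q B = set0 /\ q (A `|` B) = q A `|` q B].

Definition q_solid (X Y : Type) (n : nat) (T : 'I_(n.*2.-1) -> Y -> X)
    (A : set X) : set Y :=
  \bigcup_(S in [set S : {set 'I_(n.*2.-1)} | (n <= #|S|)%N])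
    \bigcap_(i in [set` S]) (T i @^-1` A).

(* The extension is unique on open and compact sets only; [xget] picks one. *)
Definition q_ext (X Y : topologicalType) (n : nat)
    (T : 'I_(n.*2.-1) -> Y -> X) : set X -> set Y :=
  xget (fun=> set0)
    [set q : set X -> set Y | image_transformation q /\
      forall A, solid A -> open A \/ closed A -> q A = q_solid T A].

Definition gdsm_odd (R : realType) (Y : ptopologicalType)
    (P : set (borelType Y) -> \bar R) (X : topologicalType) (n : nat)
    (T : 'I_(n.*2.-1) -> Y -> X) (A : set X) : \bar R :=
  P (q_ext T A).

(* T_1, ..., T_m, T_j *)
Definition repeat_map (X Y : Type) (m : nat) (T : 'I_m -> Y -> X) (j : 'I_m)
    (i : 'I_m.+1) : Y -> X :=
  T (odflt j (unlift ord_max i)).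

(* 'I_(n.*2.+1) is convertible to 'I_(n.+1.*2.-1). *)
Definition gdsm_even (R : realType) (Y : ptopologicalType)
    (P : set (borelType Y) -> \bar R) (X : topologicalType) (n : nat)
    (T : 'I_(n.*2) -> Y -> X) (A : set X) : \bar R :=
  ((n.*2)%:R^-1%:E * \sum_(j < n.*2) @gdsm_odd R Y P X n.+1 (repeat_map T j) A)%E.

Definition drop_map (X Y : Type) (m : nat) (T : 'I_m -> Y -> X) (j : 'I_m)
    (i : 'I_m.-1) : Y -> X :=
  T (lift j i).

(* k counts from 1. *)
Definition order_stat (R : realType) (Y : Type) (m : nat) (k : nat)
    (T : 'I_m -> Y -> R) (y : Y) : R :=
  nth 0 (sort <=%R [seq T i y | i <- enum 'I_m]) k.-1.

Definition corestrict (Y Z : Type) (X : set Z) (f : Y -> Z)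
    (fX : forall y, X (f y)) (y : Y) : X :=
  exist _ (f y) (mem_set (fX y)).

(* Main.v *)
Require Import Defs.
From mathcomp Require Import measurable_realfun.
From mathcomp Require Import zify ring.

Import Order.TTheory GRing.Theory Num.Theory.
Import numFieldNormedType.Exports.

(* On a solid subset of an interval, which is an initial or a final segment,
   a majority of the values lies in it iff their median does; and the preimage
   under the continuous median is an image transformation. An image
   transformation is determined by its values on points, and
   {x} = [x, d] \ (x, d] is a difference of solid sets, which yields (i).
   For the even case, adjoining T_j to the sample, resp. deleting T_j, moves
   the median to one of the two middle order statistics, according to the half
   of the sorted sample in which T_j lies; each of them occurs for n of the
   2n indices j. Integrating this pointwise count yields (ii) and (iii). *)

Set Implicit Arguments.
Unset Strict Implicit.

Local Open Scope classical_set_scope.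
Local Open Scope ring_scope.

(** * Entries of a sorted list, handled by counting *)

Lemma nth_sort_le (R : realType) (s : seq R) (k : nat) (x : R) :
  (k < size s)%N ->
  (nth 0 (sort <=%R s) k <= x) = (k < count (<= x)%R s)%N.
Proof.
move=> ks; have sS : sorted <=%R (sort <=%R s) by exact: sort_le_sorted.
rewrite -(count_sort <=%R); apply/idP/idP => [kx|]; last exact: nth_count_le.
rewrite ltnNge; apply: contraTN kx => ck; rewrite -ltNge.
by apply: nth_count_gt => //; rewrite ck size_sort.
Qed.

Lemma nth_sort_leq (R : realType) (s : seq R) (i j : nat) :
  (i <= j < size s)%N -> nth 0 (sort <=%R s) i <= nth 0 (sort <=%R s) j.
Proof.
move=> /andP[ij js].
have sS : sorted <=%R (sort <=%R s) by exact: sort_le_sorted.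
apply: (sorted_leq_nth le_trans lexx) => //; rewrite inE size_sort //.
exact: leq_ltn_trans js.
Qed.

Lemma eq_le_all (R : realType) (a b : R) :
  (forall x, (a <= x) = (b <= x)) -> a = b.
Proof. by move=> ab; apply/le_anti; rewrite ab lexx -ab lexx. Qed.

(** If [a] is at most entry [n], inserting it pushes that entry to position [n.+1]. Otherwise [a],
    being itself an entry of [s], is at least entry [n.+1], and inserting a second copy leaves
    position [n.+1] unchanged. *)
Lemma nth_sort_cons (R : realType) (s : seq R) (n : nat) (a : R) :
  (n.+1 < size s)%N -> a \in s ->
  nth 0 (sort <=%R (a :: s)) n.+1 =
  nth 0 (sort <=%R s) (if a <= nth 0 (sort <=%R s) n then n else n.+1).
Proof.
move=> ns aS; have n's := ltnW ns.
apply: eq_le_all => x; rewrite nth_sort_le /=; last by rewrite ltnS ltnW.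
case: ifPn => [an|]; rewrite ?nth_sort_le// ?addnS ?ltnS.
  move: an; have [ax _|ax an] := leP a x; first by rewrite add1n ltnS.
  rewrite add0n; apply/idP/idP; first by move/ltnW.
  by rewrite -nth_sort_le// => nx; move: (le_trans an nx); rewrite leNgt ax.
rewrite -ltNge => na; have [ax|ax] := leP a x; last by rewrite add0n.
rewrite add1n ltnS; apply/idP/idP; last exact: ltnW.
move=> _; rewrite -nth_sort_le//; apply: le_trans ax.
move: aS; rewrite -(mem_sort <=%R) => /(nthP 0)[i]; rewrite size_sort => iS ai.
rewrite -ai; apply: nth_sort_leq; rewrite iS andbT.
rewrite ltnNge; apply: contraTN na => ni; rewrite -leNgt -ai.
by apply: nth_sort_leq; rewrite ni.
Qed.

(** Deleting [a] shifts the entries behind it down by one and leaves the earlier ones in place. *)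
Lemma nth_sort_behead (R : realType) (s : seq R) (n : nat) (a : R) :
  (n < size s)%N ->
  nth 0 (sort <=%R s) n =
  nth 0 (sort <=%R (a :: s))
    (if a <= nth 0 (sort <=%R (a :: s)) n then n.+1 else n).
Proof.
move=> ns; have nas : (n.+1 < size (a :: s))%N by [].
apply: eq_le_all => x; rewrite nth_sort_le//.
case: ifPn => [an|na]; rewrite nth_sort_le//= ?(ltnW nas)//.
  have [ax|ax] := leP a x; first by rewrite add1n ltnS.
  rewrite add0n; apply/idP/idP => [nc|]; last exact: ltnW.
  move: ax; rewrite ltNge (le_trans an)// nth_sort_le// ?(ltnW nas)//=.
  by rewrite ltn_addl.
have [ax|ax] := leP a x; last by rewrite add0n.
rewrite add1n; apply/idP/idP => [|_]; first exact: ltnW.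
move: na; set t := nth _ _ _; rewrite -ltNge => ta.
(* Read through [nth_sort_le], this trivial inequality says that more than [n] entries of [a :: s]
   are at most [t]. As [t < a], all of them lie in [s]. *)
have : t <= t by [].
rewrite {1}/t nth_sort_le ?(ltnW nas)//= leNgt ta add0n => /leq_trans; apply.
by apply: sub_count => z /= /le_trans; apply; exact: le_trans (ltW ta) ax.
Qed.

(** In sorted order the first [n.+1] entries are at most [u]. A later entry at most [u] forces a tie
    of the two middle entries, and then both values of [w] agree by hypothesis, so ties do not
    disturb the count. *)
Lemma sum_sort_half (R : realType) (V : nmodType) (s : seq R) (n : nat)
    (w : bool -> V) :
  let u := nth 0 (sort <=%R s) n in
  size s = n.+1.*2 -> (u = nth 0 (sort <=%R s) n.+1 -> w true = w false) ->
  \sum_(a <- s) w (a <= u) = (w true + w false) *+ n.+1.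
Proof.
move=> u ss uv; rewrite -(perm_big _ (permEl (perm_sort <=%R s)))/=.
rewrite (big_nth 0) size_sort ss (big_cat_nat (n := n.+1))//=; last first.
  by rewrite -addnn leq_addr.
rewrite -addnn mulrnDl; congr (_ + _).
  rewrite (eq_big_nat _ _ (F2 := fun=> w true)).
    by rewrite big_const_nat subn0 iter_addr_0.
  move=> i /andP[_ ilt]; rewrite nth_sort_leq// ss; lia.
rewrite (eq_big_nat _ _ (F2 := fun=> w false)).
  by rewrite big_const_nat addnK iter_addr_0.
move=> i /andP[ni ilt].
have [iu|//] := leP (nth 0 (sort <=%R s) i) u.
apply: uv; apply/le_anti; rewrite nth_sort_leq ?ss/=; last lia.
by apply: le_trans iu; rewrite nth_sort_leq// ss -addnn ni.
Qed.

(** If [p] holds at entry [k], it holds at the more than [k] entries below or equal to it. If it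
    fails there, all entries satisfying [p] are strictly smaller, and there are at most [k] of
    those. *)
Lemma nth_sort_lower (R : realType) (s : seq R) (p : pred R) (k : nat) :
  (forall a b, a \in s -> b \in s -> a <= b -> p b -> p a) -> (k < size s)%N ->
  p (nth 0 (sort <=%R s) k) = (k < count p s)%N.
Proof.
move=> ps ks; set t := nth _ _ _.
have ts : t \in s by rewrite -(mem_sort <=%R) mem_nth// size_sort.
have sub (f g : pred R) :
    {in s, forall z, f z -> g z} -> (count f s <= count g s)%N.
  move=> fg; rewrite (@eq_in_count _ f (predI f g)); last first.
    by move=> z zs /=; case: (boolP (f z)) => // /(fg _ zs) ->.
  by apply: sub_count => z /andP[].
apply/idP/idP => [pt|].
  have : t <= t by [].
  rewrite {1}/t nth_sort_le// => /leq_trans; apply; apply: sub => z zs zt.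
  exact: (ps _ t).
apply: contraLR => npt; rewrite -leqNgt leqNgt.
apply/negP => kp.
have : t < t; last by rewrite ltxx.
apply: nth_count_lt; first exact: sort_le_sorted.
rewrite count_sort; apply: leq_trans kp _; apply: sub => z zs pz /=.
by rewrite ltNge; apply: contra npt => tz; apply: (ps _ z).
Qed.

(** * Topology of a subset regarded as a space of its own *)

Lemma set_val_inj (T : Type) (A : set T) : injective (@set_val T A).
Proof. by move=> [a Aa] [b Ab] /= ab; exact: eq_exist. Qed.

Lemma image_set_valE (T : Type) (A : set T) (B : set A) (a : A) :
  (set_val @` B) (set_val a) = B a.
Proof. by rewrite propeqE; split=> [[b Bb /set_val_inj <-]|Ba] //; exists a. Qed.

Lemma set_type_hausdorff (T : topologicalType) (A : set T) :
  hausdorff_space T -> hausdorff_space A.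
Proof.
move=> hT p q pq; apply: set_val_inj; apply: hT => U V pU qV.
have cv := @initial_continuous A T set_val.
by have [r [/= Ur Vr]] := pq _ _ (cv p _ pU) (cv q _ qV); exists (set_val r).
Qed.

Lemma continuous_set_type (Y T : topologicalType) (A : set T) (f : Y -> A) :
  continuous (fun y => set_val (f y)) -> continuous f.
Proof.
move=> /continuousP cf; apply/continuousP => _ [U oU <-].
exact: (cf U oU).
Qed.

(** The identity of [A], extended to [T] by the default value [a0], inverts [set_val]. It is
    continuous on [A], so compactness and connectedness pass from subsets of [T] back to the
    subspace. *)
Lemma image_valL (T : Type) (A : set T) (a0 : A) (B : set A) :
  'valL_a0 (@id A) @` (set_val @` B) = B.
Proof.
have K a : 'valL_a0 (@id A) (set_val a) = a.
  have := congr1 (fun h => h id a) (@sigL_valL _ _ a0 A); exact.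
apply/seteqP; split=> [_ [_ [b Bb <-] <-]|b Bb]; first by rewrite K.
by exists (set_val b); [exists b|exact: K].
Qed.

Lemma within_valL (T : topologicalType) (A : set T) (a0 : A) (B : set A) :
  {within set_val @` B, continuous 'valL_a0 (@id A)}.
Proof.
have : {within A, continuous 'valL_a0 (@id A)}.
  by apply/subspace_valL_continuousP' => x; exact: cvg_id.
by apply: continuous_subspaceW; exact: sub_setP.
Qed.

Lemma set_type_compact (T : topologicalType) (A : set T) (a0 : A) :
  compact A -> compact [set: A].
Proof.
move=> cA; rewrite -(image_valL a0 setT).
apply: continuous_compact; first exact: within_valL.
suff -> : set_val @` [set: A] = A by [].
apply/seteqP; split => [|a Aa]; first exact: sub_setP.
by exists (exist _ a (mem_set Aa)).
Qed.

Lemma set_type_connectedP (T : topologicalType) (A : set T) (a0 : A)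
    (B : set A) :
  connected B <-> connected (set_val @` B).
Proof.
split=> cB; last first.
  rewrite -(image_valL a0 B).
  by apply: connected_continuous_connected => //; exact: within_valL.
apply: connected_continuous_connected => //; apply: continuous_subspaceT.
exact: (@initial_continuous A T set_val).
Qed.

(** * Image transformations and their determination by points *)

Lemma image_transformation_preimage (X Y : topologicalType) (m : Y -> X) :
  hausdorff_space X -> compact [set: Y] -> continuous m ->
  image_transformation (fun A => m @^-1` A).
Proof.
move=> hX cY cm; have hA := hausdorff_accessible hX; split.
- by move=> U oU; exact: ((continuousP _).1 cm U oU).
- move=> K /(compact_closed hX) cK; apply: (subclosed_compact _ cY) => //.
  exact: ((continuous_closedP _).1 cm K cK).
- move=> U oU; apply/seteqP; split=> [y Uy|y [K [KU _] Ky]]; last exact: KU.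
  by exists [set m y] => //=; split; [move=> _ ->|exact: compact_set1].
(* If [m y] is not in [K], the complement of the point [m y] is an open set containing [K] whose
   preimage omits [y]. *)
- move=> K cK; apply/seteqP; split=> [y Ky U [KU _]|y yU]; first exact: KU.
  apply: contrapT => nKy; apply: (yU (~` [set m y])) => //; split.
    by move=> x Kx /= xy; apply: nKy; rewrite /preimage/= -xy.
  by apply: closed_openC; exact: accessible_closed_set1.
- move=> A B _ _ _ AB; rewrite -preimage_setU; split => //.
  by rewrite -preimage_setI AB preimage_set0.
Qed.

Lemma image_transformation_sub1 (X Y : topologicalType) (q : set X -> set Y)
    (A : set X) (x : X) :
  image_transformation q -> open A \/ compact A -> A x -> q [set x] `<=` q A.
Proof.
move=> [_ _ qo qc _] oA Ax y qy.
have sub U : open U -> U x -> q U y.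
  move=> oU Ux; rewrite qo//; exists [set x] => //=; split.
    by move=> _ ->.
  exact: compact_set1.
case: oA => [oA|cA]; first exact: sub.
by rewrite qc// => U [AU oU]; apply: sub => //; exact: AU.
Qed.

(** The inclusion on points spreads to every open or closed set by monotonicity. Applied to the
    complement of [A] as well, it gives equality, since [q] sends [A] and its complement to disjoint
    sets. *)
Lemma image_transformation_unique (X Y : topologicalType) (q : set X -> set Y)
    (m : Y -> X) :
  hausdorff_space X -> compact [set: X] -> image_transformation q ->
  q setT = setT -> (forall x, m @^-1` [set x] `<=` q [set x]) ->
  forall A, open A \/ closed A -> q A = m @^-1` A.
Proof.
move=> hX cX qI qT q1 A oA.
have clc (B : set X) : closed B -> compact B.
  by move=> cB; exact: subclosed_compact cX _.
have sub B : open B \/ closed B -> m @^-1` B `<=` q B.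
  move=> oB y By; apply: (image_transformation_sub1 qI _ By); last exact: q1.
  by case: oB => oB; [left|right; exact: clc].
apply/seteqP; split; last exact: sub.
move=> y qAy; apply: contrapT => nAy.
have oAC : open (~` A) \/ closed (~` A).
  by case: oA => ?; [right; exact: open_closedC|left; exact: closed_openC].
have OK (B : set X) : open B \/ closed B -> open B \/ compact B.
  by case=> oB; [left|right; exact: clc].
have [_ _ _ _ qU] := qI.
have [//||] := qU A (~` A) (OK _ oA) (OK _ oAC).
- by rewrite setUCr; left; exact: openT.
- exact: setICr.
- by move=> + _; rewrite -subset0 => /(_ y); apply; split => //; exact: sub.
Qed.

(** * Continuity of order statistics *)

Lemma size_sample (R : realType) (Y : Type) (m : nat) (T : 'I_m -> Y -> R) y :
  size [seq T i y | i <- enum 'I_m] = m.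
Proof. by rewrite size_map size_enum_ord. Qed.

(** Each index whose value at [z] is at most the order statistic there has value at [y] at most that
    number plus [e]. Used in both directions, this makes order statistics 1-Lipschitz for the
    maximum norm, hence continuous. *)
Lemma order_stat_leD (R : realType) (Y : Type) (m k : nat) (T : 'I_m -> Y -> R)
    (y z : Y) (e : R) :
  (0 < k <= m)%N -> (forall i, T i y <= T i z + e) ->
  order_stat k T y <= order_stat k T z + e.
Proof.
move=> km Te; have k'm : (k.-1 < m)%N by lia.
rewrite /order_stat nth_sort_le ?size_sample//.
have : order_stat k T z <= order_stat k T z by [].
rewrite {1}/order_stat nth_sort_le ?size_sample// => /leq_trans; apply.
rewrite !count_map; apply: sub_count => i /= iz.
by rewrite (le_trans (Te i))// lerD2r.
Qed.

Lemma order_stat_continuous (R : realType) (Y : topologicalType) (m k : nat)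
    (T : 'I_m -> Y -> R) :
  (0 < k <= m)%N -> (forall i, continuous (T i)) -> continuous (order_stat k T).
Proof.
move=> km cT y; apply/cvgrPdist_le => e e0.
have : \forall z \near y, forall i, `|T i y - T i z| <= e.
  by apply: filter_forall => i; move: e e0; apply/cvgrPdist_le; exact: cT.
apply: filterS => z Tz.
rewrite ler_distl lerBlDr; apply/andP; split; apply: order_stat_leD => // i;
  by move: (Tz i); rewrite ler_distl lerBlDr => /andP[].
Qed.

Lemma order_stat_mem (R : realType) (Y : Type) (m k : nat) (T : 'I_m -> Y -> R)
    (y : Y) :
  (0 < k <= m)%N -> exists i, order_stat k T y = T i y.
Proof.
move=> km; have : order_stat k T y \in sort <=%R [seq T i y | i <- enum 'I_m].
  by apply: mem_nth; rewrite size_sort size_sample; lia.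
by rewrite mem_sort => /mapP[i _ ->]; exists i.
Qed.

(** An order statistic is one of the sample values, so it stays in [I]. The factored map [med] is
    what the image transformation results apply to. *)
Lemma order_stat_corestrict (R : realType) (Y : topologicalType) (I : set R)
    (m k : nat) (T : 'I_m -> Y -> I) :
  (0 < k <= m)%N -> (forall i, continuous (T i)) ->
  exists2 med : Y -> I, continuous med &
    forall A, order_stat k (fun i y => set_val (T i y)) @^-1` (set_val @` A) =
              med @^-1` A.
Proof.
move=> km cT; set v := fun i y => set_val (T i y).
have vI y : I (order_stat k v y).
  by have [i ->] := order_stat_mem v y km; exact: set_valP.
exists (corestrict vI); last first.
  by move=> A; apply/funext => y; exact: (image_set_valE A (corestrict vI y)).
apply: continuous_set_type; apply: order_stat_continuous => // i.
move=> y; apply: continuous_comp; first exact: cT.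
exact: (@initial_continuous I R set_val).
Qed.

(** * Solid sets, majorities and the median *)

Lemma q_solidE (X Y : Type) (n : nat) (T : 'I_(n.*2.-1) -> Y -> X) (A : set X)
    (y : Y) :
  q_solid T A y = (n <= count (fun i => `[<A (T i y)>]) (enum 'I_(n.*2.-1)))%N.
Proof.
rewrite propeqE.
have -> : count (fun i => `[<A (T i y)>]) (enum 'I_(n.*2.-1)) =
    #|[set i | `[<A (T i y)>]]%SET|.
  rewrite -sum1_count big_enum_cond -sum1_card; apply: eq_bigl => i.
  by rewrite inE.
split=> [[S nS SA]|nA].
  apply: leq_trans nS _; apply/subset_leq_card/fintype.subsetP => i iS.
  by rewrite inE; apply/asboolP; exact: (SA i).
exists [set i | `[<A (T i y)>]]%SET => // i /=.
by rewrite inE => /asboolP.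
Qed.

(** If both alternatives failed, there would be a step into [A] and a step out of [A] along the
    order. Depending on their relative position, [A] or its complement would then have a gap,
    against connectedness. *)
Lemma solid_monotone (R : realType) (I : set R) (A : set I) :
  solid A -> (forall a b : I, set_val a <= set_val b -> A b -> A a) \/
             (forall a b : I, set_val a <= set_val b -> A a -> A b).
Proof.
move=> [cA cAC].
have [+|] := pselect (forall a b : I, set_val a <= set_val b -> A b -> A a).
  by left.
move=> /existsNP[a /existsNP[b /not_implyP[ab /not_implyP[Ab nAa]]]]; right.
move=> a' b' ab' Aa'; apply: contrapT => nAb'.
move: cA cAC => /(set_type_connectedP a)/connected_intervalP cA.
move=> /(set_type_connectedP a)/connected_intervalP cAC.
have [aa'|/ltW aa'] := leP (set_val a) (set_val a').
  have := cAC (set_val a) (set_val b') _ _ (set_val a').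
  by rewrite !image_set_valE aa'; apply.
have := cA (set_val a') (set_val b) _ _ (set_val a).
by rewrite !image_set_valE aa' => H; apply: nAa; apply: H.
Qed.

Lemma q_solid_order_stat (R : realType) (Y : Type) (I : set R) (n : nat)
    (T : 'I_(n.*2.-1) -> Y -> I) (A : set I) :
  (0 < n)%N -> solid A ->
  q_solid T A = order_stat n (fun i y => set_val (T i y)) @^-1` (set_val @` A).
Proof.
move=> n0 sA; apply/funext => y; rewrite q_solidE /preimage/= /order_stat.
set s := map _ _; pose p (r : R) := `[<(set_val @` A) r>].
have ss : size s = n.*2.-1 by rewrite /s size_map size_enum_ord.
have ns : (n.-1 < size s)%N by rewrite ss; lia.
have pE z : p (set_val z) = `[<A z>] by rewrite /p image_set_valE.
have -> : count (fun i => `[<A (T i y)>]) (enum 'I_(n.*2.-1)) = count p s.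
  by rewrite /s [RHS]count_map; apply: eq_count => i /=; rewrite pE.
suff -> : (n <= count p s)%N = p (nth 0 (sort <=%R s) n.-1).
  by rewrite asboolE.
have [lA|uA] := solid_monotone sA.
  rewrite nth_sort_lower//; first by rewrite prednK.
  move=> _ _ /mapP[i _ ->] /mapP[j _ ->] ij.
  by rewrite !pE => /asboolP/(lA _ _ ij)/asboolP.
(* Here the complement is the initial segment. Of [n.*2.-1] values, at least [n] lie in [A] exactly
   when at most [n.-1] lie outside. *)
rewrite -[RHS]negbK -[~~ p _]/(predC p _) nth_sort_lower//.
  by rewrite -leqNgt; have := count_predC p s; rewrite ss; lia.
move=> _ _ /mapP[i _ ->] /mapP[j _ ->] ij /=.
by rewrite !pE; apply: contra => /asboolP/(uA _ _ ij)/asboolP.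
Qed.

Lemma convex_connected (R : realType) (c d : R) (B : set `[c, d]%classic) :
  (forall a b z, B a -> B b -> set_val a <= set_val z <= set_val b -> B z) ->
  connected B.
Proof.
move=> cB; have [->|/set0P[a0 _]] := eqVneq B set0; first exact: connected0.
apply/(set_type_connectedP a0)/connected_intervalP.
move=> _ _ [a Ba <-] [b Bb <-] r arb.
have Xr : `[c, d]%classic r.
  have := set_valP a; have := set_valP b.
  rewrite /= !in_itv/= => /andP[_ bd] /andP[ca _].
  by case/andP: arb => ar rb; rewrite (le_trans ca ar) (le_trans rb bd).
exists (exist _ r (mem_set Xr)) => //.
exact: (cB a b).
Qed.

Lemma solid_upper (R : realType) (c d : R) (B : set `[c, d]%classic) :
  (forall a z, B a -> set_val a <= set_val z -> B z) -> solid B.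
Proof.
move=> uB; split; apply: convex_connected.
  by move=> a b z Ba _ /andP[az _]; exact: uB Ba az.
by move=> a b z _ nBb /andP[_ zb] Bz; apply: nBb; exact: uB Bz zb.
Qed.

Lemma q_ext_order_stat (R : realType) (Y : ptopologicalType) (c d : R) (n : nat)
    (T : 'I_(n.*2.-1) -> Y -> `[c, d]%classic) (A : set `[c, d]%classic) :
  (0 < n)%N -> compact [set: Y] -> (forall i, continuous (T i)) ->
  open A \/ closed A ->
  q_ext T A = order_stat n (fun i y => set_val (T i y)) @^-1` (set_val @` A).
Proof.
set X := `[c, d]%classic in T A *.
move=> n0 cY cT oA; have nm : (0 < n <= n.*2.-1)%N by rewrite n0/=; lia.
have [med cmed medE] := order_stat_corestrict nm cT; rewrite medE.
have hX : hausdorff_space X by apply: set_type_hausdorff; exact: Rhausdorff.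
have cX : compact [set: X].
  by apply: (set_type_compact (med point)); exact: segment_compact.
(* The preimage under the median is a witness, so [xget] returns a genuine extension and not its
   default value. *)
have [|qI qs] := @xgetPex _ (fun=> set0) [set q : set X -> set Y |
    image_transformation q /\
    forall A, solid A -> open A \/ closed A -> q A = q_solid T A].
  exists (fun A => med @^-1` A); split.
    exact: image_transformation_preimage.
  by move=> B sB _; rewrite q_solid_order_stat.
rewrite -/(q_ext T) in qI qs; set q := q_ext T in qI qs *.
have qmed B : solid B -> open B \/ closed B -> q B = med @^-1` B.
  by move=> sB oB; rewrite qs// q_solid_order_stat// medE.
move: A oA; apply: image_transformation_unique => //.
  by rewrite qmed//; [exact: solid_upper|left; exact: openT].
move=> x y /= yx.
have cval := @initial_continuous X R set_val.
(* Both final segments are solid. When the median at [y] is [x], the point [y] lies in the image of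
   [G'] but not in that of [G], so additivity puts it in the image of the point [x]. *)
pose G := [set z : X | set_val x < set_val z].
pose G' := [set z : X | set_val x <= set_val z].
have GG' : G' = [set x] `|` G.
  apply/seteqP; split=> z; rewrite /G /G' /=.
    by rewrite le_eqVlt => /orP[/eqP/set_val_inj ->|]; [left|right].
  by case=> [->//|/ltW].
have oG : open G.
  exact: (continuousP _).1 cval _ (@open_gt _ (set_val x)).
have cG' : closed G'.
  exact: (continuous_closedP _).1 cval _ (@closed_ge _ (set_val x)).
have qG' : q G' y.
  rewrite qmed; [by rewrite /G' /preimage/= yx| |by right].
  by apply: solid_upper => a z /=; exact: le_trans.
have nqG : ~ q G y.
  rewrite qmed; [by rewrite /G /preimage/= yx ltxx| |by left].
  by apply: solid_upper => a z /=; exact: lt_le_trans.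
have [_ _ _ _ /(_ [set x] G)] := qI; rewrite -GG'; case.
- by right; exact: compact_set1.
- by left.
- by right; exact: (subclosed_compact cG' cX).
- by apply/seteqP; split=> // z [->]; rewrite /G /= ltxx.
- by move=> _ qE; move: qG'; rewrite qE => -[|/nqG].
Qed.

(** * Adjoining or deleting one map of an even sample *)

Lemma perm_enum_lift (m : nat) (j : 'I_m) :
  perm_eq (j :: map (lift j) (enum 'I_m.-1)) (enum 'I_m).
Proof.
apply: uniq_perm;
  rewrite ?enum_uniq//= ?(map_inj_uniq lift_inj) ?enum_uniq ?andbT.
  by apply/mapP => -[i _ /eqP]; rewrite (negbTE (neq_lift _ _)).
move=> i; rewrite mem_enum inE.
case: (unliftP j i) => [k ->|->]; last by rewrite eqxx.
by rewrite map_f ?orbT// mem_enum.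
Qed.

Lemma perm_repeat_map (R : realType) (Y : Type) (m : nat) (T : 'I_m -> Y -> R)
    (j : 'I_m) (y : Y) :
  perm_eq [seq repeat_map T j i y | i <- enum 'I_m.+1]
          (T j y :: [seq T i y | i <- enum 'I_m]).
Proof.
rewrite perm_sym.
have := perm_map (fun i => repeat_map T j i y) (perm_enum_lift (@ord_max m)).
rewrite /= -map_comp /repeat_map unlift_none/=; congr (perm_eq (_ :: _) _).
by apply: eq_map => i /=; rewrite liftK.
Qed.

Lemma perm_drop_map (R : realType) (Y : Type) (m : nat) (T : 'I_m -> Y -> R)
    (j : 'I_m) (y : Y) :
  perm_eq (T j y :: [seq drop_map T j i y | i <- enum 'I_m.-1])
          [seq T i y | i <- enum 'I_m].
Proof.
have := perm_map (fun i => T i y) (perm_enum_lift j).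
by rewrite /= -map_comp.
Qed.

(** Half of the indices give each middle order statistic. The function [g] is arbitrary so that
    indicator functions can be inserted later. *)
Lemma sum_order_stat_repeat (R : realType) (V : nmodType) (Y : Type) (n : nat)
    (T : 'I_(n.*2) -> Y -> R) (g : R -> V) (y : Y) :
  (0 < n)%N ->
  \sum_(j < n.*2) g (@order_stat R Y n.*2.+1 n.+1 (repeat_map T j) y) =
  (g (order_stat n T y) + g (order_stat n.+1 T y)) *+ n.
Proof.
case: n T => // n T _; set s := [seq T i y | i <- enum 'I_(n.+1.*2)].
have ss : size s = n.+1.*2 by rewrite size_map size_enum_ord.
pose w b := g (nth 0 (sort <=%R s) (if b then n else n.+1)).
rewrite -(sum_sort_half (w := w) ss); last by rewrite /w => ->.
rewrite big_map big_enum; apply: eq_bigr => j _.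
rewrite /order_stat (perm_sort_leP _ _ (perm_repeat_map T j y)) /=.
rewrite nth_sort_cons//; first by rewrite ss; lia.
by rewrite map_f// mem_enum.
Qed.

Lemma sum_order_stat_drop (R : realType) (V : nmodType) (Y : Type) (n : nat)
    (T : 'I_(n.*2) -> Y -> R) (g : R -> V) (y : Y) :
  (0 < n)%N ->
  \sum_(j < n.*2) g (order_stat n (drop_map T j) y) =
  (g (order_stat n T y) + g (order_stat n.+1 T y)) *+ n.
Proof.
case: n T => // n T _; set s := [seq T i y | i <- enum 'I_(n.+1.*2)].
have ss : size s = n.+1.*2 by rewrite size_map size_enum_ord.
(* Deleting a value of the lower half moves the median up, whereas repeating it moves the median
   down; hence the two branches are interchanged here. *)
pose w b := g (nth 0 (sort <=%R s) (if b then n.+1 else n)).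
rewrite addrC -(sum_sort_half (w := w) ss); last by rewrite /w => ->.
rewrite big_map big_enum; apply: eq_bigr => j _.
rewrite /order_stat (nth_sort_behead (T j y)) /=.
  by rewrite (perm_sort_leP _ _ (perm_drop_map T j y)).
by rewrite size_map size_enum_ord; lia.
Qed.

(** * From pointwise counts to measures *)

Lemma sum_measure_indic (d : measure_display) (T : measurableType d)
    (R : realType) (mu : {measure set T -> \bar R}) (m n : nat)
    (E : 'I_m -> set T) (E1 E2 : set T) :
  (forall j, measurable (E j)) -> measurable E1 -> measurable E2 ->
  (forall t, \sum_(j < m) \1_(E j) t = (\1_E1 t + \1_E2 t) *+ n :> R) ->
  (\sum_(j < m) mu (E j) = n%:R%:E * (mu E1 + mu E2))%E.
Proof.
move=> mE mE1 mE2 EE.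
have indicE (A : set T) : measurable A -> (mu A = \int[mu]_t (\1_A t)%:E)%E.
  by move=> mA; rewrite integral_indic// setIT.
have mI (A : set T) : measurable A ->
    measurable_fun setT (EFin \o \1_A : T -> \bar R).
  by move=> mA; apply/measurable_EFinP; exact: measurable_indic.
have I0 (A : set T) t : setT t -> (0 <= (\1_A t)%:E :> \bar R)%E.
  by move=> _; rewrite lee_fin.
under eq_bigr do rewrite indicE//.
rewrite -ge0_integral_sum//; last by move=> j; exact: mI.
rewrite (indicE E1)// (indicE E2)//.
rewrite -ge0_integralD//; try (exact: I0 || exact: mI).
rewrite -ge0_integralZl_EFin//.
- apply: eq_integral => t _; rewrite sumEFin EE -[(_ + _) *+ n]mulr_natl.
  by rewrite EFinM.
- by move=> t _; rewrite adde_ge0 ?I0.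
- by apply: emeasurable_funD; exact: mI.
Qed.

Lemma halve_natmul (R : realType) (n : nat) (x y : \bar R) :
  (0 < n)%N -> (0 <= x)%E -> (0 <= y)%E ->
  ((n.*2)%:R^-1%:E * (n%:R%:E * (x + y)) = 2^-1%:E * x + 2^-1%:E * y)%E.
Proof.
move=> n0 x0 y0; rewrite muleA -EFinM ge0_muleDr//.
suff -> : (n.*2)%:R^-1 * n%:R = 2^-1 :> R by [].
rewrite -muln2 natrM; field.
by rewrite pnatr_eq0 -lt0n n0.
Qed.

(** Common form of both even cases: [M j] is the median after adjoining, respectively deleting, the
    map of index [j], and [f] and [g] are the two middle order statistics. *)
Lemma average_preimage (d : measure_display) (T : measurableType d)
    (R : realType) (mu : {measure set T -> \bar R}) (n : nat) (V : Type)
    (M : 'I_(n.*2) -> T -> V) (f g : T -> V) (B : set V) :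
  (0 < n)%N -> (forall j, measurable (M j @^-1` B)) ->
  measurable (f @^-1` B) -> measurable (g @^-1` B) ->
  (forall (h : V -> R) t,
     \sum_(j < n.*2) h (M j t) = (h (f t) + h (g t)) *+ n) ->
  ((n.*2)%:R^-1%:E * \sum_(j < n.*2) mu (M j @^-1` B) =
    2^-1%:E * mu (f @^-1` B) + 2^-1%:E * mu (g @^-1` B))%E.
Proof.
move=> n0 mM mf mg Mfg; rewrite -(halve_natmul n0)//; congr (_ * _)%E.
by apply: sum_measure_indic => // t; exact: (Mfg (\1_B)).
Qed.

(** * Measurability, compactness of the domain, and the theorem *)

Lemma borel_measurable (Y : ptopologicalType) (A : set Y) :
  open A \/ closed A -> measurable (A : set (borelType Y)).
Proof.
case=> [oA|cA]; first exact: sub_sigma_algebra.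
rewrite -[A]setCK; apply: measurableC; apply: sub_sigma_algebra.
exact: closed_openC.
Qed.

Lemma measurable_order_stat (R : realType) (Y : ptopologicalType) (I : set R)
    (m k : nat) (T : 'I_m -> Y -> I) (A : set I) :
  (0 < k <= m)%N -> (forall i, continuous (T i)) -> open A \/ closed A ->
  measurable (order_stat k (fun i y => set_val (T i y)) @^-1` (set_val @` A)
              : set (borelType Y)).
Proof.
move=> km cT oA; have [med cmed ->] := order_stat_corestrict km cT.
apply: borel_measurable; case: oA => ?.
  by left; apply: (continuousP _).1.
by right; apply: (continuous_closedP _).1.
Qed.

(** The whole of [Y] is the preimage of the compact interval. *)
Lemma proper_compact (R : realType) (Y : topologicalType) (c d : R)
    (f : Y -> R) :
  (forall y, `[c, d]%classic (f y)) -> proper_map f -> compact [set: Y].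
Proof.
move=> fcd /(_ _ (@segment_compact _ c d)).
by rewrite (_ : _ @^-1` _ = setT)//; apply/seteqP; split=> // y _; exact: fcd.
Qed.

Lemma corestrict_continuous (R : realType) (Y : topologicalType) (I : set R)
    (f : Y -> R) (fI : forall y, I (f y)) :
  continuous f -> continuous (corestrict fI).
Proof. by move=> cf; exact: continuous_set_type. Qed.

Unset Implicit Arguments.

Theorem theorem79 (R : realType) (Y : ptopologicalType)
    (P : probability (borelType Y) R) (c d : R) :
  hausdorff_space Y -> locally_compact [set: Y] -> regular_measure P ->
  let X : set R := `[c, d]%classic in
  (* (i) *)
  (forall (n : nat) (T : 'I_(n.*2.-1) -> Y -> R)
      (TX : forall i y, X (T i y)),
    (0 < n)%N ->
    (forall i, [/\ continuous (T i), bounded_fun (T i) & proper_map (T i)]) ->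
    let T' i := corestrict (TX i) in
    (forall A : set X, open A \/ closed A ->
      gdsm_odd P T' A = P (order_stat n T @^-1` (set_val @` A))) /\
    (forall A : set X, open A \/ compact A ->
      q_ext T' A = order_stat n T @^-1` (set_val @` A))) /\
  (forall (n : nat) (T : 'I_(n.*2) -> Y -> R)
      (TX : forall i y, X (T i y)),
    (0 < n)%N ->
    (forall i, [/\ continuous (T i), bounded_fun (T i) & proper_map (T i)]) ->
    let T' i := corestrict (TX i) in
    (* (ii) *)
    (forall A : set X, open A \/ closed A ->
      gdsm_even P T' A =
        ((2^-1)%:E * P (order_stat n T @^-1` (set_val @` A)) +
         (2^-1)%:E * P (order_stat n.+1 T @^-1` (set_val @` A)))%E) /\
    (* (iii) *)
    (forall A : set X, open A \/ closed A ->
      gdsm_even P T' A =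
        ((n.*2)%:R^-1%:E *
          \sum_(j < n.*2) gdsm_odd P (drop_map T' j) A)%E)).
Proof.
move=> _ _ _ X.
have hX : hausdorff_space X by apply: set_type_hausdorff; exact: Rhausdorff.
split=> [n T TX n0 Tp T'|n T TX n0 Tp T'].
  have cT i : continuous (T' i).
    by apply: corestrict_continuous; have [] := Tp i.
  (* As [n] is positive there is at least one map, and its properness makes [Y] compact. *)
  have i0 : 'I_(n.*2.-1) by apply: (@Ordinal _ 0); lia.
  have cY : compact [set: Y].
    by have [_ _] := Tp i0; exact: (proper_compact (TX i0)).
  split=> A oA; rewrite /gdsm_odd q_ext_order_stat//.
  by case: oA => [|cA]; [left|right; apply: compact_closed cA; exact: hX].
have cT i : continuous (T' i).
  by apply: corestrict_continuous; have [] := Tp i.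
have i0 : 'I_(n.*2) by apply: (@Ordinal _ 0); lia.
have cY : compact [set: Y].
  by have [_ _] := Tp i0; exact: (proper_compact (TX i0)).
(* This is (ii). For (iii) the average over the deleted samples is brought to the same right-hand
   side. *)
have evenE A : open A \/ closed A -> gdsm_even P T' A =
    ((2^-1)%:E * P (order_stat n T @^-1` (set_val @` A)) +
     (2^-1)%:E * P (order_stat n.+1 T @^-1` (set_val @` A)))%E.
  move=> oA; rewrite /gdsm_even /gdsm_odd.
  have cr j i : continuous (repeat_map T' j i) by exact: cT.
  under eq_bigr do rewrite q_ext_order_stat//.
  apply: (average_preimage P
    (M := fun j => @order_stat R Y _ n.+1 (repeat_map T j))) => //.
  - move=> j.
    by apply: (@measurable_order_stat R Y X _ n.+1 (repeat_map T' j)) => //; lia.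
  - by apply: (measurable_order_stat (T := T')) => //; lia.
  - by apply: (measurable_order_stat (T := T')) => //; lia.
  - by move=> h y; exact: sum_order_stat_repeat.
split=> // A oA; rewrite evenE// /gdsm_odd.
have cd j i : continuous (drop_map T' j i) by exact: cT.
under [in RHS]eq_bigr do rewrite q_ext_order_stat//.
symmetry.
apply: (average_preimage P (M := fun j => order_stat n (drop_map T j))) => //.
- by move=> j; apply: (measurable_order_stat (T := drop_map T' j)) => //; lia.
- by apply: (measurable_order_stat (T := T')) => //; lia.
- by apply: (measurable_order_stat (T := T')) => //; lia.
- by move=> h y; exact: sum_order_stat_drop.
Qed.
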